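(* Let $n\ge 2$ be an integer. There is no rotationally symmetric harmonic diffeomorphism from $(\mathbb{R}^n_*,E)$ onto $\mathbb{H}^n_*$ with the hyperbolic metric, where $\mathbb{R}^n_*=\mathbb{R}^n\setminus\{0\}$ carries the Euclidean metric $E$ and $\mathbb{H}^n_*=\mathbb{H}^n\setminus\{0\}$.
   Context: $(\mathbb{S}^{n-1},d\theta^2)$ is the standard unit $(n-1)$-sphere. In polar coordinates $(\mathbb{R}^n,E)=(\mathbb{S}^{n-1}\times[0,\infty),\,r^2d\theta^2+dr^2)$ and $\mathbb{H}^n=(\mathbb{S}^{n-1}\times[0,\infty),\,\sinh^2 r\,d\theta^2+dr^2)$; $0$ denotes the point $r=0$, so $\mathbb{R}^n_*$ and $\mathbb{H}^n_*$ are both identified with $\mathbb{S}^{n-1}\times(0,\infty)$. A $C^2$ map $u$ from (an open subset of) $\mathbb{R}^n$ to $\mathbb{H}^n$ is harmonic if in local coordinates $\triangle u^i+\sum_{\alpha=1}^n\Gamma^i_{jk}(u)\frac{\partial u^j}{\partial x^\alpha}\frac{\partial u^k}{\partial x^\alpha}=0$ for $i=1,\dots,n$ (summation over $j,k$), where $\Gamma^i_{jk}$ are the Christoffel symbols of the Levi-Civita connection of the target metric. A map from $\mathbb{R}^n_*$ to $\mathbb{H}^n_*$ is rotationally symmetric if, in the polar coordinates $(r,\theta)\in(0,\infty)\times\mathbb{S}^{n-1}$ on $\mathbb{R}^n_*$ and on $\mathbb{H}^n_*$, it has the form $u(r,\theta)=(y(r),\theta)$ for a function $y:(0,\infty)\to(0,\infty)$.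 *)

(* Defs.v *)
From mathcomp Require Import all_boot all_order all_algebra.
From mathcomp Require Import all_classical all_reals all_analysis.

Set Implicit Arguments.
Unset Strict Implicit.
Unset Printing Implicit Defensive.

Import Order.TTheory GRing.Theory Num.Theory.
Import numFieldNormedType.Exports.

Local Open Scope classical_set_scope.
Local Open Scope ring_scope.

Definition sinh {R : realType} (t : R) : R := (expR t - expR (- t)) / 2.

Section EuclideanSpace.
Context {R : realType} {n : nat}.
Implicit Types (x u v : 'rV[R]_n) (D N : set 'rV[R]_n).

(* The library norm on row vectors is the sup norm, which induces the same
   topology; the Euclidean one is [enorm]. *)
Definition dotp u v : R := \sum_(i < n) u ord0 i * v ord0 i.

Definition enorm x : R := Num.sqrt (dotp x x).

Definition sphere : set 'rV[R]_n := [set theta | enorm theta = 1].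

(* R^n minus the origin; through the polar coordinates (r, theta) |-> r theta
   it is also the underlying manifold S^(n-1) x (0, oo) of H^n minus the
   origin. *)
Definition punctured : set 'rV[R]_n := [set x | x != 0].

Definition angle x : 'rV[R]_n := (enorm x)^-1 *: x.

Definition evec (i : 'I_n) : 'rV[R]_n := delta_mx ord0 i.

Definition partial (i : 'I_n) (f : 'rV[R]_n -> R) : 'rV[R]_n -> R :=
  fun x => 'D_(evec i) f x.

(* Meant for an open D. *)
Fixpoint Ck (k : nat) D (f : 'rV[R]_n -> R) : Prop :=
  (forall x, D x -> {for x, continuous f}) /\
  match k with
  | 0 => True
  | k'.+1 => (forall i x, D x -> derivable f x (evec i)) /\
             (forall i, Ck k' D (partial i f))
  end.

Definition component (i : 'I_n) (u : 'rV[R]_n -> 'rV[R]_n) : 'rV[R]_n -> R :=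
  fun x => u x ord0 i.

Definition Ck_map (k : nat) D (u : 'rV[R]_n -> 'rV[R]_n) : Prop :=
  forall i, Ck k D (component i u).

Definition diffeomorphism (k : nat) D N (u : 'rV[R]_n -> 'rV[R]_n) : Prop :=
  exists v : 'rV[R]_n -> 'rV[R]_n,
    [/\ forall x, D x -> N (u x) /\ v (u x) = x,
        forall z, N z -> D (v z) /\ u (v z) = z,
        Ck_map k D u & Ck_map k N v].

(* A Riemannian metric is given by its Gram matrices g_ij in the global chart
   provided by the Cartesian coordinates x = r theta. *)

(* The metric f(r)^2 dtheta^2 + dr^2 away from the origin, where dtheta^2 is
   the metric of the unit sphere: the latter is induced by the Euclidean one,
   so that dtheta^2(v, w) is the scalar product of the derivatives along v and
   w of x |-> x / |x|. *)
Definition polar_metric (f : R -> R) x : 'M[R]_n :=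
  \matrix_(i, j)
    (f (enorm x) ^+ 2 * dotp ('D_(evec i) angle x) ('D_(evec j) angle x)
     + 'D_(evec i) enorm x * 'D_(evec j) enorm x).

Definition hyperbolic_metric : 'rV[R]_n -> 'M[R]_n := polar_metric sinh.

Definition christoffel (g : 'rV[R]_n -> 'M[R]_n) x (i j k : 'I_n) : R :=
  2^-1 * \sum_(l < n) invmx (g x) i l *
    (partial j (fun z => g z l k) x + partial k (fun z => g z l j) x
     - partial l (fun z => g z j k) x).

(* Harmonicity of a map from the open set D, with the Euclidean metric, to
   the open set N, with the metric g. *)
Definition harmonic_map D N (g : 'rV[R]_n -> 'M[R]_n)
    (u : 'rV[R]_n -> 'rV[R]_n) : Prop :=
  [/\ Ck_map 2 D u,
      forall x, D x -> N (u x) &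
      forall x (i : 'I_n), D x ->
        \sum_(a < n) partial a (partial a (component i u)) x
        + \sum_(a < n) \sum_(j < n) \sum_(k < n)
            christoffel g (u x) i j k
            * partial a (component j u) x * partial a (component k u) x = 0].

Definition rotationally_symmetric (u : 'rV[R]_n -> 'rV[R]_n) : Prop :=
  exists y : R -> R,
    (forall r, 0 < r -> 0 < y r) /\
    (forall r theta, 0 < r -> sphere theta -> u (r *: theta) = y r *: theta).

End EuclideanSpace.

(* Main.v *)
(* Write u x = phi(|x|) x with y(r) = r phi(r).  On the ray through the first
   basis vector, the first component of the harmonic map equation becomes, for
   Y(t) = y(exp t) and m = n - 1,
     Y'' + (m - 1) Y' = m sinh Y cosh Y >= m Y^3 / 8.
   This inequality has no positive solution on the whole line (Keller-Osserman):
   at an interior maximum of Y(t) (L^2 - t^2) on [-L, L], the first and second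
   order conditions bound that maximum by 8 L^(3/2), whence Y(0) <= 8 L^(-1/2)
   for every L >= 1. *)
Require Import Defs.
From mathcomp Require Import all_boot all_order all_algebra.
From mathcomp Require Import all_classical all_reals all_analysis.
From mathcomp Require Import ring lra.
Set Implicit Arguments.
Unset Strict Implicit.
Unset Printing Implicit Defensive.
Import Order.TTheory GRing.Theory Num.Theory.
Import numFieldNormedType.Exports.
Local Open Scope classical_set_scope.
Local Open Scope ring_scope.

(** * Directional derivatives of real functions through restriction to lines *)

Section Calculus.
Context {R : realType} {V : normedModType R}.
Implicit Types (f g : V -> R) (x v : V).

(** Both sides have the same difference quotient as a function of [h]. This carries one-variable
    rules over to directional derivatives, and back. *)
Lemma is_derive_line (W : normedModType R) (f : V -> W) x v (s : R) df :
  is_derive (s *: v + x) v f df <->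
  is_derive s 1 (fun h : R => f (h *: v + x)) df.
Proof.
have E : (fun h : R => h^-1 *: (f (h *: v + (s *: v + x)) - f (s *: v + x))) =
  (fun h : R => h^-1 *: (f ((h *: (1 : R) + s) *: v + x) - f (s *: v + x))).
  by apply/funext => h; rewrite [_%:A]mulr1 scalerDl addrA.
by split=> -[d1 d2]; split; move: d1 d2; rewrite /derivable /derive /= E.
Qed.

Lemma is_deriveM_fun f g x v (df dg : R) :
  is_derive x v f df -> is_derive x v g dg ->
  is_derive x v (fun y => f y * g y) (df * g x + f x * dg).
Proof.
move=> hf hg; apply: is_derive_eq (is_deriveM hf hg) _.
by rewrite addrC [g x *: _]mulrC.
Qed.

Lemma is_deriveD_fun f g x v (df dg : R) :
  is_derive x v f df -> is_derive x v g dg ->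
  is_derive x v (fun y => f y + g y) (df + dg).
Proof. exact: is_deriveD. Qed.

Lemma is_derive_comp1 (F : R -> R) f x v (a b : R) :
  is_derive (f x) 1 F a -> is_derive x v f b ->
  is_derive x v (fun y => F (f y)) (a * b).
Proof.
move=> hF hf; rewrite -[x]add0r -(scale0r v).
apply/(is_derive_line (fun y => F (f y))).
apply: (@is_derive1_comp R F (fun h => f (h *: v + x))).
  by rewrite scale0r add0r.
by apply/is_derive_line; rewrite scale0r add0r.
Qed.

Lemma is_deriveV_fun (F : R -> R) (r a : R) :
  F r != 0 -> is_derive r 1 F a ->
  is_derive r 1 (fun s => (F s)^-1) (- a / F r ^+ 2).
Proof.
move=> h0 h; apply: is_derive_eq (is_deriveV h0 h) _.
by rewrite [_ *: _]mulrC mulrN mulNr.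
Qed.

End Calculus.

(** * The maximum principle and the Keller-Osserman bound *)

Section Barrier.
Context {R : realType}.
Implicit Types f : R -> R.

(** Fermat's rule gives [f' c = 0]. If [d] were positive, the Caratheodory slope of [f'] at [c]
    would be positive nearby, so [f'] would be positive just to the right of [c], and the mean value
    theorem would yield a value of [f] above the maximum. *)
Lemma second_derivative_at_max f f' (a b c d : R) :
  c \in `]a, b[ -> (forall t, t \in `]a, b[ -> is_derive t 1 f (f' t)) ->
  is_derive c 1 f' d -> (forall t, t \in `]a, b[ -> f t <= f c) ->
  f' c = 0 /\ d <= 0.
Proof.
move=> cab hf hd hmax.
have /andP[ac cb] : a < c < b by move: cab; rewrite in_itv.
have f'c0 : f' c = 0.
  have leab : a <= b by rewrite ltW// (lt_trans ac).
  have [_ <-] := hf _ cab.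
  by have [_ ->] := derive1_at_max leab (fun t ht => @ex_derive _ _ _ _ _ _ _ (hf t ht)) cab hmax.
split=> //; rewrite leNgt; apply/negP => d0.
have /is_derive1_caratheodory[g [hg gc gd]] := hd.
have : \forall t \near c, 0 < g t.
  by apply: (cvgr_gt _ gc); rewrite gd.
case/nbhs_ballP => e /= e0 he.
(* The halves keep the points of [[c, c + h]] strictly inside both the ball where [g] is positive
   and []a, b[]. *)
pose h := Num.min (e / 2) ((b - c) / 2).
have h0 : 0 < h by rewrite lt_min !divr_gt0 ?subr_gt0.
have he2 : h <= e / 2 by rewrite ge_min lexx.
have hb2 : h <= (b - c) / 2 by rewrite ge_min lexx orbT.
have hin t : c <= t <= c + h -> t \in `]a, b[.
  by move=> /andP[ct th]; rewrite in_itv/=; apply/andP; split; lra.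
have cch : c < c + h by rewrite ltrDl.
have dfh t : t \in `]c, c + h[ -> is_derive t 1 f (f' t).
  by rewrite in_itv/= => /andP[ct th]; apply/hf/hin; rewrite !ltW.
have cfh : {within `[c, c + h], continuous f}.
  apply: derivable_within_continuous => t; rewrite in_itv/= => /hin/hf dft.
  exact: (@ex_derive _ _ _ _ _ _ _ dft).
have [t tI] := MVT cch dfh cfh.
rewrite in_itv/= in tI; case/andP: tI => ct tch.
rewrite [c + h]addrC addrK => E.
have : 0 < f (h + c) - f c.
  rewrite E mulr_gt0//; have := hg t; rewrite f'c0 subr0 => ->.
  rewrite mulr_gt0 ?subr_gt0//; apply: he.
  by rewrite /ball/= ltr_norml; apply/andP; split; lra.
rewrite subr_gt0 ltNge hmax//; apply: hin; apply/andP; split; lra.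
Qed.

Lemma no_entire_positive_subsolution (m : R) (Y Y1 Y2 : R -> R) : 1 <= m ->
  (forall t : R, is_derive t 1 Y (Y1 t)) -> (forall t : R, is_derive t 1 Y1 (Y2 t)) ->
  (forall t : R, 0 < Y t) ->
  ~ (forall t, m * Y t ^+ 3 / 8 <= Y2 t + (m - 1) * Y1 t).
Proof.
move=> m1 dY dY1 Y0 ineq.
suff main L : 1 <= L -> Y 0 ^+ 2 * L <= 64.
  have Y20 : 0 < Y 0 ^+ 2 by rewrite exprn_gt0.
  (* With this [L] the left-hand side is [65 + Y 0 ^+ 2], which exceeds 64. *)
  have : Y 0 ^+ 2 * (65 / Y 0 ^+ 2 + 1) <= 64.
    by apply: main; rewrite lerDr divr_ge0// ltW.
  by rewrite mulrDr mulr1 mulrCA divff ?gt_eqF//; lra.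
move=> L1.
pose p t : R := L ^+ 2 - t ^+ 2.
have dp (t : R) : is_derive t 1 p (- (2 * t)).
  have h := is_deriveB (is_derive_cst (L ^+ 2 : R) t (1 : R))
    (is_deriveX 2 (is_derive_id t (1 : R))).
  by apply: is_derive_eq h _; rewrite sub0r expr1 [_ *: _]mulr1.
have dp1 (t : R) : is_derive t 1 (fun t => - (2 * t)) (- 2).
  have h := is_deriveN (is_deriveZ 2 (is_derive_id t (1 : R))).
  by apply: is_derive_eq h _; rewrite [_ *: _]mulr1.
pose psi t := Y t * p t.
pose psi1 t := Y1 t * p t + Y t * - (2 * t).
have dpsi (t : R) : is_derive t 1 psi (psi1 t) by exact: is_deriveM_fun.
have dpsi1 (t : R) : is_derive t 1 psi1
    ((Y2 t * p t + Y1 t * - (2 * t)) + (Y1 t * - (2 * t) + Y t * - 2)).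
  by apply: is_deriveD_fun; exact: is_deriveM_fun.
have LL : - L <= L by lra.
have cpsi : {within `[- L, L], continuous psi}.
  apply: derivable_within_continuous => t _.
  exact: (@ex_derive _ _ _ _ _ _ _ (dpsi t)).
have [t0 t0L tmax] := EVT_max LL cpsi.
rewrite in_itv/= in t0L; case/andP: t0L => t0l t0r.
have psi_0 : psi 0 <= psi t0 by apply: tmax; rewrite in_itv/=; apply/andP; split; lra.
have psi_pos : 0 < psi 0.
  by rewrite /psi /p expr0n subr0 mulr_gt0// exprn_gt0//; lra.
(* [psi] vanishes at both ends and is positive at 0, so its maximum point [t0] is interior. *)
have psi_end s : s ^+ 2 = L ^+ 2 -> psi s = 0 by rewrite /psi /p => ->; rewrite subrr mulr0.
have t0l' : - L < t0.
  rewrite lt_neqAle t0l andbT; apply/eqP => E.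
  by have := psi_end t0; rewrite -E sqrrN => /(_ erefl); rewrite E; lra.
have t0r' : t0 < L.
  rewrite lt_neqAle t0r andbT; apply/eqP => E.
  by have := psi_end t0; rewrite E => /(_ erefl); rewrite -E; lra.
have [e1 e2] : psi1 t0 = 0 /\
    (Y2 t0 * p t0 + Y1 t0 * - (2 * t0)) + (Y1 t0 * - (2 * t0) + Y t0 * - 2) <= 0.
  apply: (second_derivative_at_max _ (fun t _ => dpsi t) (dpsi1 t0) (_ : forall t, t \in `]- L, L[ -> _)).
    by rewrite in_itv/= t0l'.
  by move=> t tI; apply: tmax; move: tI; rewrite !in_itv/= => /andP[? ?]; rewrite !ltW.
have p0 : 0 < p t0 by rewrite /p subr_sqr mulr_gt0//; lra.
have psi2 : psi t0 ^+ 2 <= 64 * L ^+ 3.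
  (* The values at [t0] become independent variables, with [q] standing for [L ^+ 2 - t0 ^+ 2]; from
     here on the argument is pure algebra. *)
  have qE : L ^+ 2 - t0 ^+ 2 = p t0 by [].
  move: e1 e2 (Y0 t0) (ineq t0) p0 qE; rewrite /psi /psi1.
  move: (Y t0) (Y1 t0) (Y2 t0) (p t0) => y y1 y2 q e1 e2 y0 hy q0 qE.
  have {}e1 : y1 * q = 2 * t0 * y by lra.
  have L23 : L ^+ 2 <= L ^+ 3 by rewrite [leRHS]exprS ler_peMl// sqr_ge0.
  have tq : t0 * q <= L ^+ 3.
    rewrite [leRHS]exprS; apply: (@le_trans _ _ (L * q)).
      by rewrite ler_wpM2r// ltW.
    by rewrite ler_wpM2l//; [lra|rewrite -qE; have := sqr_ge0 t0; lra].
  have tt : 8 * t0 ^+ 2 + 2 * q <= 8 * L ^+ 2.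
    by rewrite -qE; move: q0; rewrite -qE; lra.
  have q20 : 0 < q ^+ 2 by rewrite exprn_gt0.
  (* Multiplying the differential inequality by [q ^+ 2] lets both derivatives be eliminated: the
     second order condition bounds [y2 * q] by [4 * t0 * y1 + 2 * y], and the first order one
     replaces [y1 * q] by [2 * t0 * y]. *)
  have step : m * y ^+ 3 / 8 * q ^+ 2 <=
      y * (8 * t0 ^+ 2 + 2 * q + 2 * (m - 1) * (t0 * q)).
    apply: (@le_trans _ _ ((y2 + (m - 1) * y1) * q ^+ 2)); first by rewrite ler_pM2r.
    have -> : (y2 + (m - 1) * y1) * q ^+ 2 = (y2 * q) * q + (m - 1) * (y1 * q) * q.
      by ring.
    have h : y2 * q <= 4 * t0 * y1 + 2 * y by lra.
    apply: (@le_trans _ _ ((4 * t0 * y1 + 2 * y) * q + (m - 1) * (y1 * q) * q)).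
      by rewrite lerD2r ler_pM2r.
    rewrite le_eqVlt; apply/orP; left; apply/eqP.
    have -> : (4 * t0 * y1 + 2 * y) * q = 4 * t0 * (y1 * q) + 2 * y * q by ring.
    by rewrite e1; ring.
  (* Divide by [y > 0] and insert the bounds [tt] and [tq]. *)
  have step2 : m * y ^+ 2 / 8 * q ^+ 2 <= 8 * L ^+ 2 + 2 * (m - 1) * L ^+ 3.
    rewrite -(ler_pM2l y0); apply: le_trans; last first.
      apply: (le_trans step); rewrite ler_pM2l//; apply: lerD => //.
      by rewrite ler_wpM2l//; lra.
    by rewrite le_eqVlt; apply/orP; left; apply/eqP; ring.
  have m0 : 0 < m by lra.
  rewrite -(ler_pM2l m0).
  have -> : m * (y * q) ^+ 2 = 8 * (m * y ^+ 2 / 8 * q ^+ 2) by field.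
  (* The target follows from [64 L^2 + 16 (m - 1) L^3 <= 64 m L^3], which uses [L^2 <= L^3] and the
     sign of [(m - 1) L^3]. *)
  have : (m - 1) * L ^+ 3 >= 0 by rewrite mulr_ge0//; [lra|rewrite exprn_ge0//; lra].
  move: step2 L23; move: (L ^+ 2) (L ^+ 3) (m * y ^+ 2 / 8 * q ^+ 2) => a2 a3 z.
  lra.
have : psi 0 ^+ 2 <= 64 * L ^+ 3.
  by apply: le_trans psi2; rewrite ler_sqr// nnegrE; lra.
rewrite /psi /p expr0n subr0 => h.
(* Since [psi 0 = Y 0 * L ^+ 2], the bound reads [Y(0)^2 L^4 <= 64 L^3]; cancel [L^3]. *)
have L3 : 0 < L ^+ 3 by rewrite exprn_gt0//; lra.
rewrite -(ler_pM2r L3); by apply: le_trans h; rewrite le_eqVlt; apply/orP; left; apply/eqP; ring.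
Qed.

End Barrier.

(** * Derivatives of the Euclidean norm and of the angle; polar metrics in Cartesian coordinates *)

Section PolarCalculus.
Context {R : realType} {n : nat}.
Implicit Types (x z v : 'rV[R]_n) (i j k : 'I_n) (F : R -> R).

Lemma dotp_ge0 x : 0 <= dotp x x.
Proof. by apply: sumr_ge0 => i _; rewrite -expr2 sqr_ge0. Qed.

Lemma dotp_gt0 x : x != 0 -> 0 < dotp x x.
Proof.
move=> x0; rewrite lt0r dotp_ge0 andbT; apply: contra x0 => /eqP h.
apply/eqP/rowP => i; rewrite mxE; apply/eqP; rewrite -sqrf_eq0 expr2.
by apply/eqP; apply: (psumr_eq0P _ h) => // j _; rewrite -expr2 sqr_ge0.
Qed.

Lemma enorm_gt0 x : x != 0 -> 0 < enorm x.
Proof. by move=> x0; rewrite sqrtr_gt0 dotp_gt0. Qed.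

Lemma sqr_enorm x : enorm x ^+ 2 = dotp x x.
Proof. by rewrite sqr_sqrtr// dotp_ge0. Qed.

Lemma enormZ (a : R) x : 0 <= a -> enorm (a *: x) = a * enorm x.
Proof.
move=> a0; rewrite /enorm (_ : dotp _ _ = a ^+ 2 * dotp x x).
  by rewrite sqrtrM ?sqr_ge0// sqrtr_sqr ger0_norm.
by rewrite /dotp mulr_sumr; apply: eq_bigr => i _; rewrite !mxE; ring.
Qed.

Lemma dotpvE x i : dotp x (evec i) = x ord0 i.
Proof.
rewrite /dotp (bigD1 i)//= !mxE !eqxx mulr1 big1 ?addr0// => j ji.
by rewrite !mxE eqxx (negbTE ji) mulr0.
Qed.

Lemma is_derive_coord x i j :
  is_derive x (evec i) (fun z => z ord0 j) (i == j)%:R.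
Proof.
rewrite -[x]add0r -(scale0r (evec i)); apply/is_derive_line.
rewrite (_ : (fun _ => _) = (fun h : R => h * (i == j)%:R + x ord0 j)); last first.
  by apply/funext => h; rewrite !mxE eqxx eq_sym.
have h := is_deriveD_fun
  (is_deriveM_fun (is_derive_id (0 : R) (1 : R)) (is_derive_cst ((i == j)%:R : R) (0 : R) (1 : R)))
  (is_derive_cst (x ord0 j : R) (0 : R) (1 : R)).
by apply: is_derive_eq h _; rewrite addr0 mulr0 addr0 mul1r.
Qed.

Lemma is_derive_dotp x i :
  is_derive x (evec i) (fun z => dotp z z) (2 * x ord0 i).
Proof.
rewrite (_ : (fun _ => _) = \sum_(j < n) (fun z => z ord0 j * z ord0 j)); last first.
  by apply/funext => z; rewrite fct_sumE.
apply: is_derive_eq.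
  by apply: is_derive_sum => j; apply: is_deriveM_fun; exact: is_derive_coord.
rewrite (bigD1 i)//= eqxx big1 => [|j ji]; last first.
  by rewrite eq_sym (negbTE ji) mul0r mulr0 addr0.
by rewrite mul1r mulr1 addr0 mulr2n mulrDl mul1r.
Qed.

Lemma is_derive_enorm x i : x != 0 ->
  is_derive x (evec i) enorm (x ord0 i / enorm x).
Proof.
move=> x0; apply: is_derive_eq.
  apply: (is_derive_comp1 (F := Num.sqrt) _ (is_derive_dotp x i)).
  exact/is_derive1_sqrt/dotp_gt0.
rewrite -/(enorm x); field.
by rewrite gt_eqF// enorm_gt0.
Qed.

Lemma is_derive_radial F d x i : x != 0 -> is_derive (enorm x) 1 F d ->
  is_derive x (evec i) (fun z => F (enorm z)) (d * (x ord0 i / enorm x)).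
Proof. by move=> x0 h; apply: is_derive_comp1 h _; exact: is_derive_enorm. Qed.

Lemma near_neq0 x : x != 0 -> \forall z \near x, z != 0.
Proof. by move=> x0; apply: (@cvgr_neq0 _ _ _ (nbhs x) _ id x) => //; exact: cvg_id. Qed.

Lemma is_derive_angle x i : x != 0 ->
  is_derive x (evec i) angle
    ((enorm x)^-1 *: evec i - (x ord0 i / enorm x ^+ 3) *: x).
Proof.
move=> x0; have e0 : enorm x != 0 by rewrite gt_eqF// enorm_gt0.
have dj j : is_derive x (evec i) (fun z => angle z ord0 j)
    ((enorm x)^-1 * (i == j)%:R - x ord0 i / enorm x ^+ 3 * x ord0 j).
  rewrite (_ : (fun _ => _) = fun z => (fun r => r^-1) (enorm z) * z ord0 j); last first.
    by apply/funext => z; rewrite mxE.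
  apply: is_derive_eq.
    apply: is_deriveM_fun; last exact: is_derive_coord.
    apply: is_derive_radial => //.
    by apply: (is_deriveV_fun (F := id)) => //; exact: is_derive_id.
  by rewrite /=; field.
have dm : derivable angle x (evec i).
  apply/derivable_mxP => k j; rewrite (ord1 k); exact: (@ex_derive _ _ _ _ _ _ _ (dj j)).
split=> //; rewrite derive_mx//; apply/rowP => j; rewrite !mxE eqxx/=.
by have [_ ->] := dj j; rewrite eq_sym.
Qed.

(** The derivative of [angle] is [1 / |z|] times the orthogonal projection off the line of [z], and
    that of [enorm] is the scalar product with [z / |z|]. Hence the metric is [F(|z|)^2 / |z|^2]
    times the former projection plus the projection onto that line. *)
Lemma polar_metricE F z i j : z != 0 ->
  polar_metric F z i j =
  F (enorm z) ^+ 2 / enorm z ^+ 2 * (i == j)%:R +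
  (1 - F (enorm z) ^+ 2 / enorm z ^+ 2) / enorm z ^+ 2 * (z ord0 i * z ord0 j).
Proof.
move=> z0; have e0 : enorm z != 0 by rewrite gt_eqF// enorm_gt0.
rewrite mxE.
have [_ ->] := is_derive_angle i z0; have [_ ->] := is_derive_angle j z0.
have [_ ->] := is_derive_enorm i z0; have [_ ->] := is_derive_enorm j z0.
have -> : dotp ((enorm z)^-1 *: evec i - (z ord0 i / enorm z ^+ 3) *: z)
    ((enorm z)^-1 *: evec j - (z ord0 j / enorm z ^+ 3) *: z) =
  (enorm z)^-1 ^+ 2 * dotp (evec i) (evec j)
  - (enorm z)^-1 * (z ord0 j / enorm z ^+ 3) * dotp z (evec i)
  - (enorm z)^-1 * (z ord0 i / enorm z ^+ 3) * dotp z (evec j)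
  + (z ord0 i / enorm z ^+ 3) * (z ord0 j / enorm z ^+ 3) * dotp z z.
  rewrite /dotp !mulr_sumr -!sumrN -!big_split/=; apply: eq_bigr => k _.
  by rewrite !mxE; ring.
rewrite !dotpvE -sqr_enorm mxE eqxx/= [j == i]eq_sym; by field.
Qed.

End PolarCalculus.

(** * Christoffel symbols of a polar metric on the first coordinate axis *)

Section RadialChristoffel.
Context {R : realType} {n : nat}.
Implicit Types (F : R -> R).
Local Notation e0 := (evec ord0 : 'rV[R]_n.+1).

Lemma enorm_evec : enorm e0 = 1.
Proof. by rewrite /enorm dotpvE mxE !eqxx sqrtr1. Qed.

Lemma axis_neq0 (r : R) : 0 < r -> r *: e0 != 0.
Proof.
move=> r0; rewrite scaler_eq0 gt_eqF//=; apply/eqP => /rowP/(_ ord0)/eqP.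
by rewrite !mxE eqxx oner_eq0.
Qed.

Lemma enorm_axis (r : R) : 0 < r -> enorm (r *: e0) = r.
Proof. by move=> r0; rewrite enormZ ?ltW// enorm_evec mulr1. Qed.

Lemma axisE (r : R) i : (r *: e0) ord0 i = r * (i == ord0)%:R.
Proof. by rewrite !mxE. Qed.

Lemma partial_polar_metric F (z : 'rV[R]_n.+1) k i j a b : z != 0 ->
  is_derive (enorm z) 1 (fun r => F r ^+ 2 / r ^+ 2) a ->
  is_derive (enorm z) 1 (fun r => (1 - F r ^+ 2 / r ^+ 2) / r ^+ 2) b ->
  partial k (fun z => polar_metric F z i j) z =
    a * (z ord0 k / enorm z) * (i == j)%:R
    + (b * (z ord0 k / enorm z) * (z ord0 i * z ord0 j)
       + (1 - F (enorm z) ^+ 2 / enorm z ^+ 2) / enorm z ^+ 2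
         * ((k == i)%:R * z ord0 j + z ord0 i * (k == j)%:R)).
Proof.
move=> z0 ha hb.
(* The closed form is valid only off the origin, so it is differentiated through equality near
   [z]. *)
have ne : \near z, F (enorm z) ^+ 2 / enorm z ^+ 2 * (i == j)%:R +
    (1 - F (enorm z) ^+ 2 / enorm z ^+ 2) / enorm z ^+ 2 * (z ord0 i * z ord0 j)
    = polar_metric F z i j.
  by apply: filterS (near_neq0 z0) => y y0; rewrite polar_metricE.
rewrite /partial -(near_eq_derive _ ne).
have h := is_deriveD_fun
  (is_deriveM_fun (is_derive_radial k z0 ha) (is_derive_cst ((i == j)%:R : R) z (evec k)))
  (is_deriveM_fun (is_derive_radial k z0 hb)
     (is_deriveM_fun (is_derive_coord z k i) (is_derive_coord z k j))).
have [_ E] := h; rewrite [LHS]E /= mulr0 addr0.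
by congr (_ + (_ + _)); ring.
Qed.

(* No invertibility is assumed: [invmx] is the identity on singular matrices. *)
Lemma invmx_axis (G : 'M[R]_n.+1) : (forall j, G ord0 j = (j == ord0)%:R) ->
  forall j, invmx G ord0 j = (j == ord0)%:R.
Proof.
move=> hG j; have [uG|nG] := boolP (G \in unitmx); last by rewrite invmx_out.
have rG : row ord0 G = delta_mx ord0 ord0.
  by apply/rowP => k; rewrite !mxE eqxx hG.
have : row ord0 (G *m invmx G) = delta_mx ord0 ord0 *m invmx G.
  by rewrite row_mul rG.
by rewrite mulmxV// -rowE => /rowP/(_ j); rewrite !mxE eq_sym => <-.
Qed.

(** On the axis the first row of the metric is that of the identity, so only [l = 0] contributes and
    the symbol is [D_j g_0j - D_0 g_jj / 2]. As a check, it vanishes for the flat case [F r = r]. *)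
Lemma christoffel_axis F (r d : R) (j : 'I_n.+1) : 0 < r -> is_derive r 1 F d ->
  christoffel (polar_metric F) (r *: e0) ord0 j j =
  if j == ord0 then 0 else r^-1 - F r * d / r ^+ 2.
Proof.
move=> r0 hF; have rn0 : r != 0 by rewrite gt_eqF.
(* [a] and [b] are the derivatives of the two radial coefficients in [polar_metricE]. *)
pose a := 2 * F r * d / r ^+ 2 - 2 * F r ^+ 2 / r ^+ 3.
pose b := - a / r ^+ 2 - 2 * (1 - F r ^+ 2 / r ^+ 2) / r ^+ 3.
have hr2 : is_derive r 1 (fun s : R => (s ^+ 2)^-1) (- 2 / r ^+ 3).
  have h := is_deriveV_fun (F := fun s : R => s * s) (mulf_neq0 rn0 rn0)
    (is_deriveM_fun (is_derive_id r (1 : R)) (is_derive_id r (1 : R))).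
  by apply: is_derive_eq h _; field.
have ha : is_derive r 1 (fun r => F r ^+ 2 / r ^+ 2) a.
  by apply: is_derive_eq (is_deriveM_fun (is_deriveM_fun hF hF) hr2) _; rewrite /a; field.
have hb : is_derive r 1 (fun r => (1 - F r ^+ 2 / r ^+ 2) / r ^+ 2) b.
  have h1 : is_derive r 1 (fun r => 1 - F r ^+ 2 / r ^+ 2) (- a).
    apply: is_derive_eq (is_deriveB (is_derive_cst (1 : R) r (1 : R)) ha) _.
    by rewrite sub0r.
  by apply: is_derive_eq (is_deriveM_fun h1 hr2) _; rewrite /b; field.
have z0 : r *: e0 != 0 := axis_neq0 r0.
have ez : enorm (r *: e0) = r := enorm_axis r0.
have P k i l := @partial_polar_metric F (r *: e0) k i l a b z0.
rewrite ez in P.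
rewrite /christoffel.
have inv := invmx_axis (G := polar_metric F (r *: e0)) _.
rewrite (bigD1 ord0)//= inv; last first.
  move=> l; rewrite polar_metricE// ez !axisE [ord0 == l]eq_sym eqxx.
  by case: (l == ord0) => /=; field.
rewrite big1 => [|l l0]; last first.
  rewrite inv ?(negbTE l0) ?mul0r// => k; rewrite polar_metricE// ez !axisE [ord0 == k]eq_sym eqxx.
  by case: (k == ord0) => /=; field.
rewrite !P// !axisE !eqxx [ord0 == j]eq_sym addr0.
case: (j == ord0); rewrite /= /b /a; by field.
Qed.

End RadialChristoffel.

(** * Reduction of the harmonic map system to an ordinary differential equation *)

Section RadialMap.
Context {R : realType} {n : nat}.
Variables (u : 'rV[R]_n.+1 -> 'rV[R]_n.+1) (phi phi1 phi2 : R -> R).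
Hypothesis uE : forall x, x != 0 -> u x = phi (enorm x) *: x.
Hypothesis dphi : forall r : R, 0 < r -> is_derive r 1 phi (phi1 r).
Hypothesis dphi1 : forall r : R, 0 < r -> is_derive r 1 phi1 (phi2 r).
Local Notation e0 := (evec ord0 : 'rV[R]_n.+1).

Lemma partial_radial_map x a i : x != 0 ->
  partial a (component i u) x =
  phi1 (enorm x) / enorm x * (x ord0 a * x ord0 i) + phi (enorm x) * (a == i)%:R.
Proof.
move=> x0.
have ne : \near x, phi (enorm x) * x ord0 i = component i u x.
  by apply: filterS (near_neq0 x0) => y y0; rewrite /component uE// mxE.
rewrite /partial -(near_eq_derive _ ne).
have h := is_deriveM_fun (is_derive_radial a x0 (dphi (enorm_gt0 x0))) (is_derive_coord x a i).
have [_ E] := h; rewrite [LHS]E; congr (_ + _); ring.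
Qed.

Lemma partial2_radial_map x a i : x != 0 ->
  partial a (partial a (component i u)) x =
  (phi2 (enorm x) / enorm x - phi1 (enorm x) / enorm x ^+ 2) / enorm x
    * x ord0 a ^+ 2 * x ord0 i
  + phi1 (enorm x) / enorm x * (x ord0 i + 2 * x ord0 a * (a == i)%:R).
Proof.
move=> x0; have ex := enorm_gt0 x0; have en0 : enorm x != 0 by rewrite gt_eqF.
have ne : \near x, phi1 (enorm x) / enorm x * (x ord0 a * x ord0 i)
    + phi (enorm x) * (a == i)%:R = partial a (component i u) x.
  by apply: filterS (near_neq0 x0) => y y0; rewrite partial_radial_map.
rewrite {1}/partial -(near_eq_derive _ ne).
have hchi := is_deriveM_fun (dphi1 ex)
  (is_deriveV_fun (F := id) en0 (is_derive_id (enorm x) (1 : R))).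
have h := is_deriveD_fun
  (is_deriveM_fun (is_derive_radial a x0 hchi)
    (is_deriveM_fun (is_derive_coord x a a) (is_derive_coord x a i)))
  (is_deriveM_fun (is_derive_radial a x0 (dphi ex))
    (is_derive_cst ((a == i)%:R : R) x (evec a))).
have [_ E] := h; rewrite [LHS]E /= eqxx /=; by field.
Qed.

(** With [y(r) = r phi(r)] this is [y'' + n y' / r = n F(y) F'(y) / r^2] in dimension [n.+1], read
    off from the first component of the system at [r *: e0]. *)
Lemma harmonic_radial_ode F (r d : R) : 0 < r -> 0 < phi r ->
  is_derive (r * phi r) 1 F d ->
  harmonic_map punctured punctured (polar_metric F) u ->
  r * phi2 r + (2 + n%:R) * phi1 r + n%:R * (phi r / r)
  = n%:R * (F (r * phi r) * d / r ^+ 2).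
Proof.
move=> r0 p0 hF [_ _ /(_ (r *: e0) ord0 (axis_neq0 r0))].
have z0 : r *: e0 != 0 := axis_neq0 r0.
have ez : enorm (r *: e0) = r := enorm_axis r0.
have rn0 : r != 0 by rewrite gt_eqF.
have pn0 : phi r != 0 by rewrite gt_eqF.
have -> : u (r *: e0) = (r * phi r) *: e0 by rewrite uE// ez scalerA mulrC.
(* On the axis the Jacobian is diagonal: [y'] in the radial direction and [phi = y / r] in the
   others. *)
have P a i : partial a (component i u) (r *: e0) =
    (a == i)%:R * (if a == ord0 then r * phi1 r + phi r else phi r).
  rewrite partial_radial_map// ez !axisE.
  have [->|ai] := eqVneq a i; first by case: (i == ord0) => /=; field.
  case: (eqVneq a ord0) => [a0|a0]; last by rewrite /=; ring.
  by rewrite -a0 eq_sym (negbTE ai) /=; ring.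
have -> : \sum_(a < n.+1) partial a (partial a (component ord0 u)) (r *: e0)
    = r * phi2 r + (2 + n%:R) * phi1 r.
  rewrite big_ord_recl partial2_radial_map// ez !axisE eqxx.
  under eq_bigr => a _.
    rewrite partial2_radial_map// ez !axisE eqxx.
    rewrite (_ : _ + _ = phi1 r); last by rewrite /=; field.
    over.
  rewrite sumr_const card_ord -mulr_natl /=; by field.
(* The diagonal Jacobian leaves only the symbols with [j = k = a]; the radial one is zero and the
   [n] tangential ones are equal. *)
have -> : \sum_(a < n.+1) \sum_(j < n.+1) \sum_(k < n.+1)
    christoffel (polar_metric F) ((r * phi r) *: e0) ord0 j k
    * partial a (component j u) (r *: e0) * partial a (component k u) (r *: e0)
    = n%:R * (phi r / r - F (r * phi r) * d / r ^+ 2).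
  have D (a : 'I_n.+1) : \sum_(j < n.+1) \sum_(k < n.+1)
    christoffel (polar_metric F) ((r * phi r) *: e0) ord0 j k
    * partial a (component j u) (r *: e0) * partial a (component k u) (r *: e0)
    = christoffel (polar_metric F) ((r * phi r) *: e0) ord0 a a
      * (if a == ord0 then r * phi1 r + phi r else phi r) ^+ 2.
    rewrite (bigD1 a)//= [X in _ + X]big1 ?addr0 => [|j ja]; last first.
      by apply: big1 => k _; rewrite !P [a == j]eq_sym (negbTE ja) /=; ring.
    rewrite (bigD1 a)//= [X in _ + X]big1 ?addr0 => [|j ja]; last first.
      by rewrite !P [a == j]eq_sym (negbTE ja) /=; ring.
    by rewrite !P eqxx /=; ring.
  under eq_bigr do rewrite D christoffel_axis ?mulr_gt0//.
  rewrite big_ord_recl eqxx mul0r add0r.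
  rewrite (eq_bigr (fun=> phi r / r - F (r * phi r) * d / r ^+ 2)) => [|i _].
    by rewrite sumr_const card_ord mulr_natl.
  by rewrite /=; field; rewrite rn0 pn0.
move=> E; apply/eqP; rewrite -subr_eq0; apply/eqP; rewrite -E; ring.
Qed.

End RadialMap.

(** * The hyperbolic case and the change of variable [r = exp t] *)

Section Main.
Context {R : realType}.

Lemma is_derive_sinh (t : R) : is_derive t 1 sinh ((expR t + expR (- t)) / 2).
Proof.
have hN : is_derive t 1 (fun s : R => expR (- s)) (expR (- t) * -1).
  exact: (is_derive_comp1 (is_derive_expR (- t)) (is_deriveNid t 1)).
have h := is_deriveM_fun (is_deriveB (is_derive_expR t) hN)
  (is_derive_cst (2^-1 : R) t (1 : R)).
by apply: is_derive_eq h _; rewrite mulr0 addr0 mulrN1 opprK.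
Qed.

(** The product is [(exp(2t) - exp(-2t)) / 4]. Here [exp(-2t) <= 1], while [exp(2t)], the fourth
    power of [exp(t/2)], is at least [(1 + t/2)^4], whose expansion contains [1 + t^3 / 2]. *)
Lemma sinh_mul_cosh_ge (t : R) : 0 <= t ->
  t ^+ 3 / 8 <= sinh t * ((expR t + expR (- t)) / 2).
Proof.
move=> t0.
have -> : sinh t * ((expR t + expR (- t)) / 2) =
    (expR (2 * t) - expR (- (2 * t))) / 4.
  have -> : - (2 * t) = - t + - t by ring.
  have -> : 2 * t = t + t by ring.
  by rewrite /sinh !expRD; field.
have h1 : expR (- (2 * t)) <= 1 by rewrite -[leRHS]expR0 ler_expR; lra.
have h2 : (1 + t / 2) ^+ 4 <= expR (2 * t).
  have -> : 2 * t = 4 * (t / 2) by field.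
  by rewrite expRM_natl lerXn2r ?nnegrE ?expR_ge0 ?expR_ge1Dx//; lra.
have h3 : 1 + t ^+ 3 / 2 <= (1 + t / 2) ^+ 4.
  have -> : (1 + t / 2) ^+ 4 = 1 + t ^+ 3 / 2 +
    (2 * t + 3 / 2 * t ^+ 2 + t ^+ 4 / 16) by field.
  by rewrite lerDl !addr_ge0 ?mulr_ge0 ?exprn_ge0//; lra.
lra.
Qed.

End Main.

Theorem corollary1p1 (R : realType) (n : nat) (hn : (2 <= n)%N) :
  ~ exists u : 'rV[R]_n -> 'rV[R]_n,
      [/\ rotationally_symmetric u,
          harmonic_map punctured punctured hyperbolic_metric u &
          diffeomorphism 2 punctured punctured u].
Proof.
(* From here on the dimension is [n.+1], so the new [n], at least 1, is the [m] of the overview. *)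
case: n hn => [//|n] hn [u [[y [y0 uy]] hu _]].
pose e0 : 'rV[R]_n.+1 := evec ord0.
have [/(_ ord0) [_ [d1 /(_ ord0) [_ [d2 _]]]] _ _] := hu.
(* No regularity is assumed of [y]; it agrees for [r > 0] with [u0], which is differentiated through
   the partial derivatives of [u] along the axis. *)
pose u0 (r : R) := u (r *: e0) ord0 ord0.
pose u1 (r : R) := partial ord0 (component ord0 u) (r *: e0).
pose u2 (r : R) := partial ord0 (partial ord0 (component ord0 u)) (r *: e0).
have axis (f : 'rV[R]_n.+1 -> R) (r : R) : derivable f (r *: e0) e0 ->
    is_derive r 1 (fun s => f (s *: e0)) (partial ord0 f (r *: e0)).
  rewrite -[r *: e0]addr0 => /derivableP /is_derive_line h.
  by move: h; under eq_fun do rewrite addr0.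
have du0 (r : R) : 0 < r -> is_derive r 1 u0 (u1 r).
  by move=> r0; apply: (axis (component ord0 u)); apply/d1/axis_neq0.
have du1 (r : R) : 0 < r -> is_derive r 1 u1 (u2 r).
  by move=> r0; apply: axis; apply/d2/axis_neq0.
have u0E (r : R) : 0 < r -> u0 r = y r.
  move=> r0; rewrite /u0 uy// ?mxE ?eqxx ?mulr1//.
  by rewrite /sphere/= enorm_evec.
(* The quotient [y / r] and, by the quotient rule, its first two derivatives. *)
pose phi (r : R) := u0 r / r.
pose phi1 (r : R) := u1 r / r - u0 r / r ^+ 2.
pose phi2 (r : R) := u2 r / r - 2 * u1 r / r ^+ 2 + 2 * u0 r / r ^+ 3.
have dinv (r : R) : 0 < r -> is_derive r 1 (fun s : R => s^-1) (- 1 / r ^+ 2).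
  move=> r0; have rn0 : r != 0 by rewrite gt_eqF.
  exact: (is_deriveV_fun (F := id) rn0 (is_derive_id r (1 : R))).
have dphi (r : R) : 0 < r -> is_derive r 1 phi (phi1 r).
  move=> r0; apply: is_derive_eq (is_deriveM_fun (du0 r r0) (dinv r r0)) _.
  by rewrite /phi1; field; rewrite gt_eqF.
have dphi1 (r : R) : 0 < r -> is_derive r 1 phi1 (phi2 r).
  move=> r0; have rn0 : r != 0 by rewrite gt_eqF.
  have h := is_deriveB (is_deriveM_fun (du1 r r0) (dinv r r0))
    (is_deriveM_fun (is_deriveM_fun (du0 r r0) (dinv r r0)) (dinv r r0)).
  rewrite (_ : phi1 = (fun s => u1 s * s^-1) - (fun s => u0 s * s^-1 * s^-1)).
    by apply: is_derive_eq h _; rewrite /phi2; field.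
  by apply/funext => s; rewrite /phi1 expr2 invfM mulrA.
have phi0 (r : R) : 0 < r -> 0 < phi r by move=> r0; rewrite divr_gt0// u0E// y0.
have uE x : x != 0 -> u x = phi (enorm x) *: x.
  move=> x0; have ex := enorm_gt0 x0.
  have {1}-> : x = enorm x *: angle x by rewrite scalerA divff ?scale1r// gt_eqF.
  rewrite uy//; last by rewrite /sphere/= enormZ ?invr_ge0 ?ltW// mulVf// gt_eqF.
  by rewrite scalerA -u0E.
have ode (r : R) (r0 : 0 < r) := harmonic_radial_ode uE dphi dphi1 r0 (phi0 r r0)
  (is_derive_sinh (r * phi r)) hu.
(* The substitution turns [(0, oo)] into the whole line and [r^2 y'' + n r y'] into
   [Y'' + (n - 1) Y'], with constant coefficients. *)
pose Y (t : R) := u0 (expR t).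
pose Y1 (t : R) := u1 (expR t) * expR t.
pose Y2 (t : R) := u2 (expR t) * expR t ^+ 2 + u1 (expR t) * expR t.
have dY (t : R) : is_derive t 1 Y (Y1 t).
  exact: (is_derive_comp1 (du0 _ (expR_gt0 t)) (is_derive_expR t)).
have dY1 (t : R) : is_derive t 1 Y1 (Y2 t).
  apply: is_derive_eq (is_deriveM_fun
    (is_derive_comp1 (du1 _ (expR_gt0 t)) (is_derive_expR t)) (is_derive_expR t)) _.
  by rewrite /Y2; ring.
have Ypos (t : R) : 0 < Y t by rewrite /Y u0E ?y0 ?expR_gt0.
apply: (no_entire_positive_subsolution (m := n%:R) _ dY dY1 Ypos).
  by rewrite ler1n.
move=> t; have r0 := expR_gt0 t; have := ode _ r0.
have rn0 : expR t != 0 by rewrite gt_eqF.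
have -> : expR t * phi (expR t) = Y t by rewrite /phi mulrC divfK.
have := sinh_mul_cosh_ge (ltW (Ypos t)).
set S := sinh _ * _; move=> hS E.
have -> : Y2 t + (n%:R - 1) * Y1 t = n%:R * S.
  (* Rewritten so that the right-hand side of the radial equation appears, multiplied by [r^2]. *)
  have -> : n%:R * S = expR t ^+ 2 * (n%:R * (S / expR t ^+ 2)) by field.
  by rewrite -E /phi2 /phi1 /phi /Y2 /Y1; field.
by rewrite -mulrA ler_wpM2l.
Qed.
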